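(* Let $k$ be an infinite field. Then there exist a commutative ring $B$ and a prime ideal $\mathfrak{q}\in\operatorname{Spec}B$ such that $B$ is HMCM, but the localization $B_{\mathfrak{q}}$ is not HMCM.
   Context: All rings are commutative with identity. Weakly proregular sequences: for a ring $R$, $\underline{a}=a_1,\dots,a_r\in R$ and $n\geq 0$ write $\underline{a}^n=a_1^n,\dots,a_r^n$ and let $H_i(\underline{a}^n)$ be the $i$-th Koszul homology of $\underline{a}^n$ on $R$. For $m\geq n$ there is a natural map $\varphi_{mn}\colon H_i(\underline{a}^m)\to H_i(\underline{a}^n)$ induced by the tensor product over $j$ of the chain maps $K_\bullet(a_j^m)\to K_\bullet(a_j^n)$ which are the identity in degree $0$ and multiplication by $a_j^{m-n}$ in degree $1$. The sequence $\underline{a}$ is weakly proregular if for every $1\leq i\leq r$ and every $n\geq 0$ there is $m\geq n$ with $\varphi_{mn}=0$. Parameter sequences: $\underline{a}=a_1,\dots,a_r$ is a parameter sequence if (1) it is weakly proregular; (2) $\underline{a}R\neq R$; (3) for every prime ideal $P$ containing $\underline{a}$, $\check{H}^r(\underline{a},R)_P\neq 0$, where $\check{H}^r(\underline{a},R)$ is the $r$-th cohomology of the Čech complex of $\underline{a}$ on $R$. It is a strong parameter sequence if $a_1,\dots,a_i$ is a parameter sequence for every $i=1,\dots,r$. HMCM: $R$ is HMCM (Cohen–Macaulay in the sense of Hamilton–Marley) if every strong parameter sequence of $R$ is a regular sequence on $R$ (each $a_i$ is a non-zero-divisor on $R/(a_1,\dots,a_{i-1})R$, and $R/\underline{a}R\neq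 0$). *)

(* Defs.v *)
From HB Require Import structures.
From mathcomp Require Import all_boot all_algebra.
From mathcomp Require Import ring.
From mathcomp Require Import boolp.

Set Implicit Arguments.
Unset Strict Implicit.
Unset Printing Implicit Defensive.

Import GRing.Theory.

Local Open Scope ring_scope.
Local Open Scope quotient_scope.

Definition nontrivial_module (R : nzRingType) (V : lmodType R) : Prop :=
  exists x : V, x != 0.

Section QuotientModule.
Variables (R : nzRingType) (V : lmodType R) (N : submodClosed V).

Definition submod_pred : {pred V} := fun x => x \in N.

Fact submod_pred_zmod_closed : zmod_closed submod_pred.
Proof.
split=> [|x y Nx Ny]; first exact: (rpred0 N).
by apply: (@rpredD _ N) => //; rewrite -scaleN1r (@rpredZ _ _ N).
Qed.

HB.instance Definition _ :=
  GRing.isZmodClosed.Build V submod_pred submod_pred_zmod_closed.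

Definition quotmod : Type := Quotient.quot submod_pred.

HB.instance Definition _ := GRing.Zmodule.on quotmod.
HB.instance Definition _ := EqQuotient.on quotmod.

Definition quotmod_class (x : V) : quotmod := \pi_quotmod x.

Definition quotmod_scale (c : R) (x : quotmod) : quotmod :=
  quotmod_class (c *: repr x).

Lemma quotmodP x y : quotmod_class x = quotmod_class y <-> x - y \in N.
Proof.
by split; [move/eqP; rewrite -Quotient.idealrBE
          |move=> h; apply/eqP; rewrite -Quotient.idealrBE].
Qed.

Fact quotmod_class_is_zmod_morphism : zmod_morphism quotmod_class.
Proof. by move=> x y; rewrite /quotmod_class /= raddfB. Qed.

HB.instance Definition _ :=
  GRing.isZmodMorphism.Build V quotmod quotmod_class
    quotmod_class_is_zmod_morphism.

Lemma quotmod_classK x : quotmod_class (repr x) = x.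
Proof. by rewrite /quotmod_class reprK. Qed.

Lemma quotmod_scaleE c x :
  quotmod_scale c (quotmod_class x) = quotmod_class (c *: x).
Proof.
apply/quotmodP; rewrite -scalerBr rpredZ //; apply/quotmodP.
exact: quotmod_classK.
Qed.

Fact quotmod_scaleA c d x :
  quotmod_scale c (quotmod_scale d x) = quotmod_scale (c * d) x.
Proof. by rewrite -[x]quotmod_classK !quotmod_scaleE scalerA. Qed.

Fact quotmod_scale1 : left_id 1 quotmod_scale.
Proof. by move=> x; rewrite -[x]quotmod_classK quotmod_scaleE scale1r. Qed.

Fact quotmod_scaleDr : right_distributive quotmod_scale +%R.
Proof.
move=> c x y; rewrite -[x]quotmod_classK -[y]quotmod_classK.
by rewrite -raddfD !quotmod_scaleE -raddfD scalerDr.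
Qed.

Fact quotmod_scaleDl x : {morph quotmod_scale^~ x : c d / c + d}.
Proof.
by move=> c d; rewrite -[x]quotmod_classK !quotmod_scaleE -raddfD scalerDl.
Qed.

HB.instance Definition _ :=
  GRing.Zmodule_isLmodule.Build R quotmod
    quotmod_scaleA quotmod_scale1 quotmod_scaleDr quotmod_scaleDl.

End QuotientModule.

Arguments quotmod_class {R V} N x.

Section Homology.
Variables (R : nzRingType) (U V W : lmodType R).
Variables (f : {linear U -> V}) (g : {linear V -> W}).

Definition cycle_pred : {pred V} := fun x => g x == 0.

Fact cycle_pred_closed : submod_closed cycle_pred.
Proof.
split=> [|c x y]; rewrite !unfold_in ?raddf0 // => /eqP gx /eqP gy.
by rewrite linearP gx gy scaler0 addr0.
Qed.

HB.instance Definition _ :=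
  GRing.isSubmodClosed.Build R V cycle_pred cycle_pred_closed.

Definition cycles : Type := {x : V | x \in cycle_pred}.

HB.instance Definition _ := Choice.on cycles.
HB.instance Definition _ := SubType.on cycles.
HB.instance Definition _ := [SubChoice_isSubLmodule of cycles by <:].

Definition boundary_pred : {pred cycles} :=
  fun z => `[< exists u : U, f u = val z >].

Fact boundary_pred_closed : submod_closed boundary_pred.
Proof.
split=> [|c x y]; rewrite !unfold_in.
  by apply/asboolP; exists 0; rewrite !raddf0.
move=> /asboolP[u fu] /asboolP[v fv]; apply/asboolP.
by exists (c *: u + v); rewrite !linearP /= fu fv.
Qed.

HB.instance Definition _ :=
  GRing.isSubmodClosed.Build R cycles boundary_pred boundary_pred_closed.

Definition homology : Type := quotmod boundary_pred.

HB.instance Definition _ := GRing.Lmodule.on homology.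

Definition homology_class (z : cycles) : homology :=
  quotmod_class boundary_pred z.

End Homology.

Section HomologyMap.
Variables (R : nzRingType) (U V W U' V' W' : lmodType R).
Variables (f : {linear U -> V}) (g : {linear V -> W}).
Variables (f' : {linear U' -> V'}) (g' : {linear V' -> W'}).

(** The map induced by [phi : V -> V'].  It is only meaningful when [phi] is
    part of a chain map; the default value of [insubd] is then never used. *)
Definition homology_map (phi : V -> V') (x : homology f g) : homology f' g' :=
  homology_class f' (insubd (0 : cycles g') (phi (val (repr x)))).

Lemma homology_mapE (phi : {additive V -> V'}) (psi : U -> U') z z' :
    (forall x, g x = 0 -> g' (phi x) = 0) ->
    (forall u, phi (f u) = f' (psi u)) ->
  val z' = phi (val z) ->
  homology_map phi (homology_class f z) = homology_class f' z'.
Proof.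
move=> phi_cycle phi_bound e; apply/quotmodP; apply/asboolP.
have /quotmodP/asboolP[u fu] :
    homology_class f (repr (homology_class f z)) = homology_class f z.
  exact: quotmod_classK.
exists (psi u); rewrite -phi_bound fu !raddfB /= e; congr (_ - _).
rewrite val_insubd; case: ifP => //; rewrite unfold_in => /negP[].
by apply/eqP/phi_cycle/eqP; exact: (valP (repr (homology_class f z))).
Qed.

End HomologyMap.

Arguments homology_map {R U V W U' V' W'} f g f' g' phi x.

Section Localization.
Variables (R : comNzRingType) (S : mulrClosed R) (V : lmodType R).

Definition denominator : Type := {s : R | s \in S}.
HB.instance Definition _ := Choice.on denominator.

Definition den (s : denominator) : R := proj1_sig s.

Lemma denP s : den s \in S. Proof. exact: proj2_sig s. Qed.

Definition denom1 : denominator := exist _ 1 (rpred1 S).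
Definition denomM (s t : denominator) : denominator :=
  exist _ (den s * den t) (rpredM (denP s) (denP t)).

Lemma den1 : den denom1 = 1. Proof. by []. Qed.
Lemma denM s t : den (denomM s t) = den s * den t. Proof. by []. Qed.

Arguments den : simpl never.
Arguments denomM : simpl never.

Definition loc_equiv : rel (V * denominator) := fun x y =>
  `[< exists2 u, u \in S &
        u *: (den y.2 *: x.1) = u *: (den x.2 *: y.1) >].

Fact loc_equiv_refl : reflexive loc_equiv.
Proof. by move=> x; apply/asboolP; exists 1; rewrite ?rpred1. Qed.

Fact loc_equiv_sym : symmetric loc_equiv.
Proof.
by move=> x y; apply/asboolP/asboolP => -[u Su e]; exists u.
Qed.

Fact loc_equiv_trans : transitive loc_equiv.
Proof.
move=> y x z /asboolP[u Su e] /asboolP[v Sv e']; apply/asboolP.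
exists (u * v * den y.2); first by rewrite !rpredM ?(denP y.2).
rewrite !scalerA in e e' *.
have -> : u * v * den y.2 * den z.2 = (v * den z.2) * (u * den y.2) by ring.
rewrite -scalerA e scalerA.
have -> : v * den z.2 * (u * den x.2) = u * den x.2 * (v * den z.2) by ring.
by rewrite -scalerA e' scalerA; congr (_ *: _); ring.
Qed.

Canonical loc_equiv_equiv :=
  EquivRel loc_equiv loc_equiv_refl loc_equiv_sym loc_equiv_trans.

Definition loc : Type := {eq_quot loc_equiv}.

HB.instance Definition _ : EqQuotient _ loc_equiv loc := EqQuotient.on loc.
HB.instance Definition _ := Choice.on loc.

Definition frac (m : V) (s : denominator) : loc := \pi_loc (m, s).

Lemma fracP m s m' s' :
  frac m s = frac m' s' <->
  exists2 u, u \in S & u *: (den s' *: m) = u *: (den s *: m').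
Proof.
split; first by move/eqmodP/asboolP.
by move=> h; apply/eqmodP/asboolP.
Qed.

Lemma frac_repr (x : loc) : frac (repr x).1 (repr x).2 = x.
Proof. by rewrite /frac -surjective_pairing reprK. Qed.

Lemma locW (P : loc -> Prop) : (forall m s, P (frac m s)) -> forall x, P x.
Proof. by move=> h x; rewrite -[x]frac_repr. Qed.

Lemma frac_eq m s m' s' :
  den s' *: m = den s *: m' -> frac m s = frac m' s'.
Proof. by move=> e; apply/fracP; exists 1; rewrite ?rpred1 // e. Qed.

Definition loc_zero : loc := frac 0 denom1.
Definition loc_opp (x : loc) : loc := frac (- (repr x).1) (repr x).2.
Definition loc_add (x y : loc) : loc :=
  frac (den (repr y).2 *: (repr x).1 + den (repr x).2 *: (repr y).1)
       (denomM (repr x).2 (repr y).2).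
Definition loc_scale (c : R) (x : loc) : loc :=
  frac (c *: (repr x).1) (repr x).2.

Lemma repr_fracP m s : exists2 u, u \in S &
  u *: (den s *: (repr (frac m s)).1) = u *: (den (repr (frac m s)).2 *: m).
Proof. by apply/fracP; rewrite frac_repr. Qed.

Lemma loc_oppE m s : loc_opp (frac m s) = frac (- m) s.
Proof.
have [u Su e] := repr_fracP m s; apply/fracP; exists u => //.
by rewrite !scalerN e.
Qed.

Lemma loc_scaleE c m s : loc_scale c (frac m s) = frac (c *: m) s.
Proof.
have [u Su e] := repr_fracP m s; apply/fracP; exists u => //.
have -> v t : u *: (t *: (c *: v)) = c *: (u *: (t *: v)).
  by rewrite !scalerA; congr (_ *: _); ring.
by rewrite e !scalerA; congr (_ *: _); ring.
Qed.

Lemma loc_addE m s n t :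
  loc_add (frac m s) (frac n t) = frac (den t *: m + den s *: n) (denomM s t).
Proof.
have [u Su e] := repr_fracP m s; have [v Sv f] := repr_fracP n t.
rewrite /loc_add; set x := repr (frac m s) in e *.
set y := repr (frac n t) in f *.
apply/fracP; exists (u * v); first exact: rpredM.
rewrite ?(denM, den1) /= !scalerDr; congr (_ + _).
  transitivity ((v * den t * den y.2) *: (u *: (den s *: x.1))).
    by rewrite !scalerA; congr (_ *: _); ring.
  by rewrite e !scalerA; congr (_ *: _); ring.
transitivity ((u * den s * den x.2) *: (v *: (den t *: y.1))).
  by rewrite !scalerA; congr (_ *: _); ring.
by rewrite f !scalerA; congr (_ *: _); ring.
Qed.

Fact loc_addA : associative loc_add.
Proof.
elim/locW=> m s; elim/locW=> n t; elim/locW=> p u.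
rewrite !loc_addE; apply: frac_eq; rewrite !denM.
rewrite !scalerDr !scalerA addrA.
by congr (_ *: _ + _ *: _ + _ *: _); ring.
Qed.

Fact loc_addC : commutative loc_add.
Proof.
elim/locW=> m s; elim/locW=> n t; rewrite !loc_addE.
by apply: frac_eq; rewrite ?(denM, den1) /= addrC [den t * _]mulrC.
Qed.

Fact loc_add0 : left_id loc_zero loc_add.
Proof.
elim/locW=> m s; rewrite loc_addE scaler0 add0r.
by apply: frac_eq; rewrite ?(denM, den1) /= scale1r mul1r.
Qed.

Fact loc_addN : left_inverse loc_zero loc_opp loc_add.
Proof.
elim/locW=> m s; rewrite loc_oppE loc_addE scalerN addNr.
by apply: frac_eq; rewrite ?(denM, den1) /= !scaler0.
Qed.

HB.instance Definition _ :=
  GRing.isZmodule.Build loc loc_addA loc_addC loc_add0 loc_addN.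

Lemma fracD m s n t :
  frac m s + frac n t = frac (den t *: m + den s *: n) (denomM s t).
Proof. exact: loc_addE. Qed.

Fact loc_scaleA c d x : loc_scale c (loc_scale d x) = loc_scale (c * d) x.
Proof. by elim/locW: x => m s; rewrite !loc_scaleE scalerA. Qed.

Fact loc_scale1 : left_id 1 loc_scale.
Proof. by elim/locW=> m s; rewrite loc_scaleE scale1r. Qed.

Fact loc_scaleDr : right_distributive loc_scale +%R.
Proof.
move=> c; elim/locW=> m s; elim/locW=> n t.
rewrite fracD !loc_scaleE fracD; apply: frac_eq; rewrite !denM.
by rewrite !scalerDr !scalerA; congr (_ *: _ + _ *: _); ring.
Qed.

Fact loc_scaleDl x : {morph loc_scale^~ x : c d / c + d}.
Proof.
elim/locW: x => m s c d; rewrite !loc_scaleE fracD; apply: frac_eq; rewrite !denM.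
rewrite scalerDl !scalerDr !scalerA.
by congr (_ *: _ + _ *: _); ring.
Qed.

HB.instance Definition _ :=
  GRing.Zmodule_isLmodule.Build R loc
    loc_scaleA loc_scale1 loc_scaleDr loc_scaleDl.

Lemma fracZ c m s : c *: frac m s = frac (c *: m) s.
Proof. exact: loc_scaleE. Qed.

End Localization.

Arguments frac {R S V} m s.
Arguments den {R S} s : simpl never.
Arguments denomM {R S} s t : simpl never.

(** The natural map [m / s |-> (c m) / (c s)], with [c s \in T], from S^-1 V to
    T^-1 V; it exists when every element of [S] divides an element of [T]. *)
Section LocalizationMap.
Variables (R : comNzRingType) (S T : mulrClosed R) (V : lmodType R).

Definition loc_map (x : loc S V) : loc T V :=
  let m := (repr x).1 in let s := den (repr x).2 in
  if pselect (exists c, c * s \in T) is left h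
  then frac (sval (cid h) *: m) (exist _ (sval (cid h) * s) (svalP (cid h)))
  else 0.

Hypothesis S_dvd_T : forall s, s \in S -> exists c, c * s \in T.

Lemma loc_map_frac m (s : denominator S) c (t : denominator T) :
  c * den s = den t -> loc_map (frac m s) = frac (c *: m) t.
Proof.
move=> ct; have [u Su e] := repr_fracP m s.
rewrite /loc_map; set x := repr (frac m s) in e *.
case: pselect => [h|[]]; last exact: S_dvd_T (denP _).
case: (cid h) => d Td /=; have [w Tw] := S_dvd_T Su.
apply/fracP; exists (w * u) => //=.
rewrite -ct; transitivity ((w * d * c) *: (u *: (den s *: x.1))).
  by rewrite !scalerA; congr (_ *: _); ring.
by rewrite e [den (exist _ _ _)]/den /= !scalerA; congr (_ *: _); ring.
Qed.

Lemma loc_map_is_linear : linear loc_map.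
Proof.
move=> a; elim/locW=> m s; elim/locW=> n t.
have [c Tc] := S_dvd_T (denP s); have [d Td] := S_dvd_T (denP t).
have [s' es'] : exists s' : denominator T, den s' = c * den s.
  by exists (exist _ (c * den s) Tc).
have [t' et'] : exists t' : denominator T, den t' = d * den t.
  by exists (exist _ (d * den t) Td).
rewrite fracZ fracD (@loc_map_frac _ _ (c * d) (denomM s' t')); last first.
  by rewrite !denM es' et'; ring.
rewrite (@loc_map_frac _ s c s') // (@loc_map_frac _ t d t') // fracZ fracD.
congr frac; rewrite es' et' !scalerDr !scalerA.
by congr (_ *: _ + _ *: _); ring.
Qed.

End LocalizationMap.

Section LocalRing.
Variables (R : comNzRingType) (P : prime_idealr R).

Definition prime_compl : {pred R} := fun x => x \notin P.

Fact prime_compl_closed : mulr_closed prime_compl.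
Proof.
split=> [|x y]; first by apply/negbT; exact: (idealr1 P).
move=> /negP Px /negP Py; apply/negP => /=.
by rewrite (prime_idealrM P) => /orP[].
Qed.

HB.instance Definition _ := GRing.isMulClosed.Build R prime_compl prime_compl_closed.

Definition ring_at : Type := loc prime_compl R^o.

HB.instance Definition _ := GRing.Zmodule.on ring_at.

Definition ring_at_frac (a : R) (s : denominator prime_compl) : ring_at :=
  @frac R prime_compl R^o a s.

Lemma ring_at_fracP (a b : R) s t :
  ring_at_frac a s = ring_at_frac b t <->
  exists2 u : R, u \notin P & u * (den t * a) = u * (den s * b).
Proof. exact: (@fracP R prime_compl R^o). Qed.

Lemma ring_atW (Q : ring_at -> Prop) :
  (forall a s, Q (ring_at_frac a s)) -> forall x, Q x.
Proof. exact: (@locW R prime_compl R^o). Qed.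

Lemma ring_at_fracD a s b t :
  ring_at_frac a s + ring_at_frac b t =
  ring_at_frac (den t * a + den s * b) (denomM s t).
Proof. exact: (@fracD R prime_compl R^o). Qed.

Definition ring_at_one : ring_at := ring_at_frac 1 (denom1 _).
Definition ring_at_mul (x y : ring_at) : ring_at :=
  let a : R := (repr x).1 in let b : R := (repr y).1 in
  ring_at_frac (a * b) (denomM (repr x).2 (repr y).2).

Lemma ring_at_mulE (a b : R) s t :
  ring_at_mul (ring_at_frac a s) (ring_at_frac b t) =
  ring_at_frac (a * b) (denomM s t).
Proof.
rewrite /ring_at_mul; set x := repr (ring_at_frac a s).
set y := repr (ring_at_frac b t).
have [u Su e] : exists2 u : R, u \notin P & u * (den s * x.1) = u * (den x.2 * a).
  exact: (@repr_fracP R prime_compl R^o).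
have [v Sv f] : exists2 v : R, v \notin P & v * (den t * y.1) = v * (den y.2 * b).
  exact: (@repr_fracP R prime_compl R^o).
apply/ring_at_fracP; exists (u * v).
  by rewrite (prime_idealrM P) negb_or Su.
rewrite !denM; move: (x.1 : R) (y.1 : R) e f => m n e f.
transitivity ((u * (den s * m)) * (v * (den t * n))); first by ring.
by rewrite e f; ring.
Qed.

Lemma ring_at_frac_eq (a b : R) s t :
  den t * a = den s * b -> ring_at_frac a s = ring_at_frac b t.
Proof. exact: (@frac_eq R prime_compl R^o). Qed.

Fact ring_at_mulA : associative ring_at_mul.
Proof.
elim/ring_atW=> a s; elim/ring_atW=> b t; elim/ring_atW=> c u.
rewrite (ring_at_mulE b c) (ring_at_mulE a b) !ring_at_mulE.
by apply: ring_at_frac_eq; rewrite !denM; ring.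
Qed.

Fact ring_at_mulC : commutative ring_at_mul.
Proof.
elim/ring_atW=> a s; elim/ring_atW=> b t; rewrite !ring_at_mulE.
by apply: ring_at_frac_eq; rewrite !denM; ring.
Qed.

Fact ring_at_mul1 : left_id ring_at_one ring_at_mul.
Proof.
elim/ring_atW=> a s; rewrite ring_at_mulE.
by apply: ring_at_frac_eq; rewrite !denM den1; ring.
Qed.

Fact ring_at_mulDl : left_distributive ring_at_mul +%R.
Proof.
elim/ring_atW=> a s; elim/ring_atW=> b t; elim/ring_atW=> c u.
rewrite ring_at_fracD (ring_at_mulE a c) (ring_at_mulE b c) !ring_at_mulE.
by rewrite ring_at_fracD; apply: ring_at_frac_eq; rewrite !denM; ring.
Qed.

Fact ring_at_one_neq0 : ring_at_one != 0.
Proof.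
apply/eqP => /ring_at_fracP[u Pu]; rewrite !den1 !mul1r mulr1 mulr0 => u0.
by move: Pu; rewrite u0 (idealr0 P).
Qed.

HB.instance Definition _ :=
  GRing.Zmodule_isComNzRing.Build ring_at
    ring_at_mulA ring_at_mulC ring_at_mul1 ring_at_mulDl ring_at_one_neq0.

End LocalRing.

Section DirectSum.
Variables (R : nzRingType) (I : finType) (M : I -> lmodType R).

Definition dirsum : Type := {dffun forall i : I, M i}.
HB.instance Definition _ := Choice.on dirsum.

Implicit Types x y : dirsum.

Definition dirsum_zero : dirsum := [ffun i : I => 0 : M i].
Definition dirsum_opp x : dirsum := [ffun i : I => - x i : M i].
Definition dirsum_add x y : dirsum := [ffun i : I => x i + y i : M i].
Definition dirsum_scale (c : R) x : dirsum := [ffun i : I => c *: x i : M i].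

Fact dirsum_addA : associative dirsum_add.
Proof. by move=> x y z; apply/ffunP=> i; rewrite !ffunE addrA. Qed.

Fact dirsum_addC : commutative dirsum_add.
Proof. by move=> x y; apply/ffunP=> i; rewrite !ffunE addrC. Qed.

Fact dirsum_add0 : left_id dirsum_zero dirsum_add.
Proof. by move=> x; apply/ffunP=> i; rewrite !ffunE add0r. Qed.

Fact dirsum_addN : left_inverse dirsum_zero dirsum_opp dirsum_add.
Proof. by move=> x; apply/ffunP=> i; rewrite !ffunE addNr. Qed.

HB.instance Definition _ :=
  GRing.isZmodule.Build dirsum dirsum_addA dirsum_addC dirsum_add0 dirsum_addN.

Fact dirsum_scaleA c d x :
  dirsum_scale c (dirsum_scale d x) = dirsum_scale (c * d) x.
Proof. by apply/ffunP=> i; rewrite !ffunE scalerA. Qed.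

Fact dirsum_scale1 : left_id 1 dirsum_scale.
Proof. by move=> x; apply/ffunP=> i; rewrite !ffunE scale1r. Qed.

Fact dirsum_scaleDr : right_distributive dirsum_scale +%R.
Proof. by move=> c x y; apply/ffunP=> i; rewrite !ffunE scalerDr. Qed.

Fact dirsum_scaleDl x : {morph dirsum_scale^~ x : c d / c + d}.
Proof. by move=> c d; apply/ffunP=> i; rewrite !ffunE scalerDl. Qed.

HB.instance Definition _ :=
  GRing.Zmodule_isLmodule.Build R dirsum
    dirsum_scaleA dirsum_scale1 dirsum_scaleDr dirsum_scaleDl.

Lemma dirsumDE x y i : (x + y) i = x i + y i. Proof. exact: ffunE. Qed.
Lemma dirsumZE c x i : (c *: x) i = c *: x i. Proof. exact: ffunE. Qed.

End DirectSum.

Definition face (r i : nat) : Type := {I : {set 'I_r} | #|I| == i}.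
HB.instance Definition _ r i := Finite.on (face r i).
HB.instance Definition _ r i := SubType.on (face r i).

(** The sign of [e_j] when it is inserted in, or removed from, e_J. *)
Definition face_sign (R : nzRingType) r (J : {set 'I_r}) (j : 'I_r) : R :=
  (-1) ^+ #|[set k in J | (k < j)%N]|.

Section Koszul.
Variables (R : comNzRingType) (r : nat).

(** The free module on the [e_I] with [#|I| = i], that is, the degree [i] part
    of the tensor product of the [K(a_j)]. *)
Definition koszul (i : nat) : lmodType R := {ffun face r i -> R^o}.

(** On basis elements, [d e_I = \sum_(j in I) +/- a_j e_(I \ j)].  The formula
    gives 0 unless [p = q.+1]; in particular [koszul_d a 0 0 = 0]. *)
Definition koszul_d (a : r.-tuple R) (p q : nat) (z : koszul p) : koszul q :=
  [ffun J : face r q =>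
     \sum_(I : face r p) \sum_(j | (j \notin val J) && (val I == j |: val J))
        face_sign R (val J) j * tnth a j * (z I : R) : R^o].

Fact koszul_d_is_linear a p q : linear (@koszul_d a p q).
Proof.
move=> c x y; apply/ffunP=> J; rewrite !ffunE.
rewrite scaler_sumr -big_split; apply: eq_bigr => I _ /=.
rewrite scaler_sumr -big_split; apply: eq_bigr => j _ /=.
by rewrite !ffunE /GRing.scale /=; ring.
Qed.

HB.instance Definition _ a p q :=
  GRing.isLinear.Build R (koszul p) (koszul q) *:%R (@koszul_d a p q)
    (@koszul_d_is_linear a p q).

Definition koszul_homology (a : r.-tuple R) (i : nat) : lmodType R :=
  homology (@koszul_d a i.+1 i) (@koszul_d a i i.-1).

Definition tuple_exp (a : r.-tuple R) (n : nat) : r.-tuple R :=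
  [tuple tnth a j ^+ n | j < r].

(** The tensor product of the maps K(a_j^m) -> K(a_j^n) that are the identity
    in degree 0 and multiplication by a_j^(m-n) in degree 1; for [n <= m]. *)
Definition koszul_pow (a : r.-tuple R) (m n i : nat) (z : koszul i) : koszul i :=
  [ffun I : face r i =>
     (\prod_(j in val I) tnth a j ^+ (m - n)) * (z I : R) : R^o].

Fact koszul_pow_is_linear a m n i : linear (@koszul_pow a m n i).
Proof.
move=> c x y; apply/ffunP=> I; rewrite !ffunE /GRing.scale /=; ring.
Qed.

HB.instance Definition _ a m n i :=
  GRing.isLinear.Build R (koszul i) (koszul i) *:%R (@koszul_pow a m n i)
    (@koszul_pow_is_linear a m n i).

Lemma koszul_pow_chain_map a m n p q (z : koszul p) : (n <= m)%N ->
  koszul_d (tuple_exp a n) q (koszul_pow a m n z) =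
  koszul_pow a m n (koszul_d (tuple_exp a m) q z) :> koszul q.
Proof.
move=> le_nm; apply/ffunP=> J; rewrite !ffunE mulr_sumr.
apply: eq_bigr => I _; rewrite mulr_sumr; apply: eq_bigr => j /andP[Jj /eqP eI].
rewrite !ffunE !tnth_mktuple eI big_setU1 //=.
have -> : tnth a j ^+ m = tnth a j ^+ n * tnth a j ^+ (m - n).
  by rewrite -exprD subnKC.
by ring.
Qed.

Definition koszul_homology_map (a : r.-tuple R) (m n i : nat) :
    koszul_homology (tuple_exp a m) i -> koszul_homology (tuple_exp a n) i :=
  homology_map _ _ _ _ (@koszul_pow a m n i).

Lemma koszul_homology_mapE a m n i
    (z : cycles (@koszul_d (tuple_exp a m) i i.-1))
    (z' : cycles (@koszul_d (tuple_exp a n) i i.-1)) : (n <= m)%N ->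
  val z' = koszul_pow a m n (val z) ->
  @koszul_homology_map a m n i (homology_class _ z) = homology_class _ z'.
Proof.
move=> le_nm; apply: (homology_mapE (psi := @koszul_pow a m n i.+1)).
  by move=> x dx; rewrite [LHS]koszul_pow_chain_map // dx raddf0.
by move=> u; rewrite [RHS]koszul_pow_chain_map.
Qed.

Definition weakly_proregular (a : r.-tuple R) : Prop :=
  forall i, (1 <= i <= r)%N -> forall n, exists2 m, (n <= m)%N &
    forall x, @koszul_homology_map a m n i x = 0.

End Koszul.

Section Cech.
Variables (R : comNzRingType) (r : nat) (a : r.-tuple R).

Definition powers (x : R) : {pred R} := fun y => `[< exists n, y = x ^+ n >].

Fact powers_closed x : mulr_closed (powers x).
Proof.
split=> [|y z]; first by apply/asboolP; exists 0.
move=> /asboolP[m ->] /asboolP[n ->]; apply/asboolP; exists (m + n)%N.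
by rewrite exprD.
Qed.

HB.instance Definition _ x := GRing.isMulClosed.Build R (powers x) (powers_closed x).

Definition face_prod (I : {set 'I_r}) : R := \prod_(j in I) tnth a j.

(** R_(a_I), where a_I is the product of the a_j with j in I. *)
Definition cech_term (I : {set 'I_r}) : lmodType R :=
  loc (powers (face_prod I)) R^o.

Definition cech (i : nat) : lmodType R :=
  dirsum (fun I : face r i => cech_term (val I)).

Lemma powers_face_prod (J : {set 'I_r}) j s :
  s \in powers (face_prod J) -> exists c, c * s \in powers (face_prod (j |: J)).
Proof.
move=> /asboolP[n ->]; have [Jj|Jj] := boolP (j \in J).
  exists 1; apply/asboolP; exists n; rewrite mul1r.
  by rewrite (setUidPr _) // sub1set.
exists (tnth a j ^+ n); apply/asboolP; exists n.
by rewrite /face_prod big_setU1 //= exprMn.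
Qed.

(** [(d x)_I = \sum_(j in I) +/- x_(I \ j)]; this is 0 unless [q = p.+1]. *)
Definition cech_d (p q : nat) (x : cech p) : cech q :=
  [ffun I : face r q =>
     \sum_(J : face r p) \sum_(j | (j \notin val J) && (val I == j |: val J))
        face_sign R (val J) j *:
          loc_map (powers (face_prod (val I))) (x J) : cech_term (val I)].

Fact cech_d_is_linear p q : linear (@cech_d p q).
Proof.
move=> c x y; apply/ffunP=> I; rewrite dirsumDE dirsumZE !ffunE.
rewrite scaler_sumr -big_split; apply: eq_bigr => J _ /=.
rewrite scaler_sumr -big_split; apply: eq_bigr => j /andP[_ /eqP eI] /=.
rewrite dirsumDE dirsumZE loc_map_is_linear; last first.
  by move=> s; rewrite eI; exact: powers_face_prod.
by rewrite scalerDr !scalerA [c * _]mulrC.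
Qed.

HB.instance Definition _ p q :=
  GRing.isLinear.Build R (cech p) (cech q) *:%R (@cech_d p q)
    (@cech_d_is_linear p q).

Definition cech_cohomology (i : nat) : lmodType R :=
  homology (@cech_d i.-1 i) (@cech_d i i.+1).

End Cech.

Section HMCM.
Variable R : comNzRingType.

Definition ideal_of (s : seq R) : {pred R^o} :=
  fun x => `[< exists c : 'I_(size s) -> R, x = \sum_i c i * s`_i >].

Fact ideal_of_closed s : submod_closed (ideal_of s).
Proof.
split=> [|b x y]; rewrite !unfold_in.
  by apply/asboolP; exists (fun=> 0); rewrite big1 // => i _; rewrite mul0r.
move=> /asboolP[c ->] /asboolP[d ->]; apply/asboolP.
exists (fun i => b * c i + d i); rewrite scaler_sumr -big_split.
by apply: eq_bigr => i _; rewrite /GRing.scale /= mulrDl mulrA.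
Qed.

HB.instance Definition _ s :=
  GRing.isSubmodClosed.Build R R^o (ideal_of s) (ideal_of_closed s).

Definition regular_sequence r (a : r.-tuple R) : Prop :=
  (forall (i : 'I_r) (x : quotmod (ideal_of (take i a))),
     tnth a i *: x = 0 -> x = 0) /\
  nontrivial_module (quotmod (ideal_of a)).

Definition parameter_sequence r (a : r.-tuple R) : Prop :=
  [/\ weakly_proregular a,
      exists x : R, x \notin ideal_of a &
      forall P : prime_idealr R, (forall x, x \in a -> x \in P) ->
        nontrivial_module (loc (prime_compl P) (cech_cohomology a r))].

Definition strong_parameter_sequence r (a : r.-tuple R) : Prop :=
  forall i, (1 <= i <= r)%N -> parameter_sequence [tuple of take i a].

Definition HMCM : Prop :=
  forall r (a : r.-tuple R), strong_parameter_sequence a -> regular_sequence a.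

End HMCM.

(* Main.v *)
Require Import Defs.
From HB Require Import structures.
From mathcomp Require Import all_boot all_algebra.
From mathcomp Require Import ring.
From mathcomp Require Import boolp classical_sets functions cardinality filter.
From mathcomp Require Import fintype finset.

(* Let B be the ring of pairs (f, d), with f in Z_(2) and d a sequence in Z/4,
   such that d_n = f mod 2 for all large n, and let q be the prime of the pairs
   with f even.

   If z = (f, d) is not a unit, then some d_n is even: otherwise f is odd, and z
   is invertible.  The idempotent at n then kills z^2 and lies outside the prime
   {d_n even}, which contains z, so H^1(z) vanishes at that prime.  Hence B has
   no parameter sequence of length one, and B is HMCM because its only strong
   parameter sequence is the empty one.

   Localizing at q kills every sequence with finite support, so none of these
   primes survives.  In B_q let y = (2, 0) and x = (0, (2, 2, ...)).  All the
   annihilators Ann(y^m), for m > 0, agree with Ann(y), which consists of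
   nilpotent elements; so y is weakly proregular, and 1 / y is nonzero in H^1 at
   every prime containing y.  Thus y is a strong parameter sequence, but it is
   not regular, since y x = 0 and x is nonzero in B_q. *)

Set Implicit Arguments.
Unset Strict Implicit.
Unset Printing Implicit Defensive.

Import GRing.Theory.

Local Open Scope ring_scope.

Lemma quotmod_classZ (R : nzRingType) (V : lmodType R) (N : submodClosed V)
  c x : c *: quotmod_class N x = quotmod_class N (c *: x).
Proof. exact: quotmod_scaleE. Qed.

(** * Koszul and Čech complexes of a sequence of length one *)

Section LengthOne.
Variables (R : comNzRingType).
Implicit Types (a : 1.-tuple R).

Lemma face0E r (I : face r 0) : val I = set0.
Proof. by apply/eqP; rewrite -cards_eq0 (valP I). Qed.

Lemma face_prod0 r (a : r.-tuple R) (I : face r 0) : face_prod a (val I) = 1.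
Proof. by rewrite /face_prod face0E big_set0. Qed.

Lemma face1E (I : face 1 1) : val I = [set ord0]%SET.
Proof.
apply/eqP; rewrite eqEcard cards1 (eqP (valP I)) andbT.
by apply/subsetP => j _; rewrite inE (ord1 j).
Qed.

Lemma face_leq r i (I : face r i) : (i <= r)%N.
Proof. by have := max_card (mem (val I)); rewrite card_ord (eqP (valP I)). Qed.

Lemma face_prod1 a (I : face 1 1) : face_prod a (val I) = tnth a ord0.
Proof. by rewrite /face_prod face1E big_set1. Qed.

Lemma sum_incidence1 (V : nmodType) (J : face 1 0) (I : face 1 1)
    (F : 'I_1 -> V) :
  \sum_(j | (j \notin val J) && (val I == j |: val J)%SET) F j = F ord0.
Proof.
by rewrite face0E face1E big_mkcond big_ord1 setU0 inE eqxx.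
Qed.

Lemma face_sign0 r (J : face r 0) j : face_sign R (val J) j = 1.
Proof.
rewrite /face_sign face0E (_ : [set k in _ | _] = set0) ?cards0 ?expr0 //.
by apply/setP => k; rewrite !inE.
Qed.

Lemma koszul_d10 a z (J : face 1 0) (I : face 1 1) :
  @koszul_d R 1 a 1 0 z J = tnth a ord0 * z I.
Proof.
rewrite ffunE (big_pred1 I) => [|I']; last first.
  by apply/esym/eqP/val_inj; rewrite !face1E.
by rewrite sum_incidence1 face_sign0 mul1r.
Qed.

Lemma cech_d01 a w (J : face 1 0) (I : face 1 1) :
  @cech_d R 1 a 0 1 w I = loc_map (powers (face_prod a (val I))) (w J).
Proof.
rewrite ffunE (big_pred1 J) => [|J']; last first.
  by apply/esym/eqP/val_inj; rewrite !face0E.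
by rewrite sum_incidence1 face_sign0 scale1r.
Qed.

(* [e] kills R_{a_0}, hence H^1, and would be invertible at [P]. *)
Lemma parameter_sequence1_annihilator a (P : prime_idealr R) e N :
    parameter_sequence a -> tnth a ord0 \in P -> e * tnth a ord0 ^+ N = 0 ->
  e \in P.
Proof.
move=> [_ _ /(_ P)] loc_neq0 Pa eaN; apply/negPn/negP => Pe.
case: loc_neq0 => [x /tnthP[i ->]|]; first by rewrite (ord1 i).
elim/locW=> c s /eqP[]; apply/fracP; exists e => //.
rewrite scaler0 den1 scale1r scaler0.
suff -> : e *: c = 0 by [].
rewrite -[c]quotmod_classK quotmod_classZ.
suff -> : e *: repr c = 0 by rewrite raddf0.
apply/val_inj/ffunP => I; rewrite /= dirsumZE ffunE.
elim/locW: (val (repr c) I) => b t; rewrite fracZ.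
apply/fracP; exists (tnth a ord0 ^+ N).
  by apply/asboolP; exists N; rewrite face_prod1.
by rewrite !scaler0 den1 scale1r /GRing.scale /= mulrCA mulrA eaN mul0r.
Qed.

Definition face00 : face 1 0 := exist _ set0 (introT eqP (cards0 _)).
Definition face11 : face 1 1 := exist _ [set ord0]%SET (introT eqP (cards1 _)).

(** A cycle at level [n.+1] is some [z] with [a_0^(n+1) z = 0], hence [a_0 z = 0], and the map down
    to level [n] multiplies by exactly [a_0]. *)
Lemma weakly_proregular1 a :
    (forall m z, tnth a ord0 ^+ m * z = 0 -> tnth a ord0 * z = 0) ->
  weakly_proregular a.
Proof.
move=> ann i; rewrite -eqn_leq => /eqP <- n; exists n.+1 => // x.
rewrite -[x]quotmod_classK.
rewrite [LHS](@koszul_homology_mapE _ _ a n.+1 n 1 (repr x) 0) //; last first.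
  apply/ffunP => I; rewrite !ffunE /= face1E big_set1 subSnn expr1.
  apply/esym/(ann n.+1).
  have /eqP/ffunP/(_ face00) := valP (repr x).
  by rewrite (koszul_d10 _ _ _ I) tnth_mktuple ffunE.
by rewrite /homology_class raddf0.
Qed.

(* The class of [1 / a_0] survives at [P]. *)
Lemma cech_top_neq0 a (P : prime_idealr R) :
    (forall s b N, tnth a ord0 ^+ N * (s - tnth a ord0 * b) = 0 -> s \in P) ->
  nontrivial_module (loc (prime_compl P) (cech_cohomology a 1)).
Proof.
move=> notP.
pose y := tnth a ord0.
have Py (I : face 1 1) : y \in powers (face_prod a (val I)).
  by apply/asboolP; exists 1%N; rewrite face_prod1 expr1.
pose z : cech a 1 := [ffun I => Defs.frac (1 : R^o) (exist _ y (Py I))].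
have z_cycle : z \in cycle_pred (@cech_d R 1 a 1 2).
  (* No face of ['I_1] has two elements, so every cochain of degree one is a cocycle. *)
  by rewrite unfold_in; apply/eqP/ffunP => I; have := face_leq I.
pose c : cech_cohomology a 1 := homology_class _ (Sub z z_cycle).
exists (Defs.frac c (denom1 _)); apply/eqP => /fracP[s Ps].
rewrite !den1 scale1r !scaler0 quotmod_classZ => /eqP.
rewrite -(raddf0 (quotmod_class _)) => /eqP/quotmodP; rewrite subr0.
move=> /asboolP[w /ffunP/(_ face11)]; rewrite (cech_d01 _ face00).
rewrite [RHS]dirsumZE ffunE; elim/locW: (w face00) => b t.
(* In degree zero only powers of the empty product 1 are inverted. *)
have den_t : den t = 1.
  by have /asboolP[n ->] := denP t; rewrite face_prod0 expr1n.
rewrite (@loc_map_frac _ _ _ _ _ _ _ 1 (denom1 _)) ?den_t ?mulr1 //; last first.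
  move=> x; rewrite face0E face1E -[[set _]%SET]setU0.
  exact: powers_face_prod.
(* The equation now reads [b / 1 = s / a_0] in the localization at [a_0]; a power of [a_0] clears
   it. *)
rewrite fracZ => /fracP[u /asboolP[N ->]].
rewrite den1 !scale1r /den /GRing.scale /= /face_prod big_set1 mulr1 => e.
by move: Ps; rewrite unfold_in (notP s b N) // mulrBr e subrr.
Qed.

End LengthOne.

(** * Criteria for violating and for satisfying HMCM *)

Lemma not_HMCM_of_annihilator (R : comNzRingType) (x y : R) :
    (forall b, y * b <> 1) ->
    (forall m z, y ^+ m * z = 0 -> y * z = 0) ->
    (forall z, y * z = 0 -> z * z = 0) ->
    y * x = 0 -> x <> 0 ->
  ~ HMCM R.
Proof.
move=> y_nonunit y_tors tors_nil yx0 x_neq0 R_HMCM.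
case: (R_HMCM 1%N [tuple y]) => [i|reg _].
  rewrite -eqn_leq => /eqP <-.
  rewrite (_ : [tuple of take 1 [tuple y]] = [tuple y]); last exact: val_inj.
  split.
  - exact: weakly_proregular1.
  - exists 1; apply/asboolP => -[c]; rewrite big_ord1 /= mulrC => /esym.
    exact: y_nonunit.
  (* [s - y * b] is killed by [y], so it squares to zero and lies in [P]; since [y] lies in [P], so
     does [s]. *)
  - move=> P Py; apply: cech_top_neq0 => s b N /y_tors.
    move=> /tors_nil e.
    have : s - y * b \in P.
      by rewrite -[_ \in P]orbb -prime_idealrM e idealr0.
    have yP : y \in P by apply: Py; rewrite mem_head.
    move=> sP; rewrite -[s](subrK (y * b)) rpredD //.
    by rewrite mulrC idealMr.
apply: x_neq0.
have /quotmodP :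
    quotmod_class (ideal_of (take 0 [tuple y])) x = quotmod_class _ 0.
  rewrite raddf0; apply: (reg ord0); rewrite quotmod_classZ /=.
  by rewrite (_ : _ *: _ = 0) ?raddf0.
by rewrite subr0 => /asboolP[c ->]; rewrite big_ord0.
Qed.

(** At [P] the element [z] becomes nilpotent, which excludes parameter sequences of length one; a
    longer strong one would begin with such a sequence. The empty sequence is regular because 1 is
    nonzero. *)
Lemma HMCM_of_locally_nilpotent (R : comNzRingType) :
    (forall z : R, (forall w, w * z <> 1) ->
      exists (P : prime_idealr R) e N,
        [/\ z \in P, e \notin P & e * z ^+ N = 0]) ->
  HMCM R.
Proof.
move=> nil [|r] a strong.
  rewrite (tuple0 a); split=> [[]//|]; exists (quotmod_class _ 1); apply/eqP.
  rewrite -[X in _ = X](raddf0 (quotmod_class _)) => /quotmodP.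
  rewrite subr0 => /asboolP[c]; rewrite big_ord0.
  by apply/eqP; rewrite oner_eq0.
suff nopar (b : 1.-tuple R) : ~ parameter_sequence b.
  (* Splitting on [r] makes the length [minn 1 r.+1] of [take 1 a] compute to 1. *)
  by case: r => [|r] in a strong *; case: (nopar _ (strong 1%N isT)).
move=> b_par; have [|P [e [N [Pb Pe ebN]]]] := nil (tnth b ord0).
  move=> w wb; have [_ [x /asboolPn xb] _] := b_par; apply: xb.
  case/tupleP: b wb {b_par} => y b; rewrite (tuple0 b) => wb.
  by exists (fun=> x * w); rewrite big_ord1 -mulrA /= wb mulr1.
by rewrite (parameter_sequence1_annihilator b_par Pb ebN) in Pe.
Qed.

(** * The criterion for violating HMCM in a localization *)

Section RingAt.
Variables (R : comNzRingType) (P : prime_idealr R).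
Implicit Types (a b x y z : R) (s t : denominator (prime_compl P)).

Lemma ring_at_fracM a b s t :
  ring_at_frac a s * ring_at_frac b t = ring_at_frac (a * b) (denomM s t).
Proof. exact: ring_at_mulE. Qed.

Lemma ring_at_frac_eq0 a s :
  ring_at_frac a s = 0 <-> exists2 u, u \notin P & u * a = 0.
Proof.
apply: (iff_trans (ring_at_fracP a 0 s (denom1 _))); rewrite den1 mul1r.
by split=> -[u Pu e]; exists u; rewrite // ?e !mulr0.
Qed.

Lemma ring_at_fracX1 y m :
  ring_at_frac y (denom1 (prime_compl P)) ^+ m =
  ring_at_frac (y ^+ m) (denom1 _).
Proof.
elim: m => // m IH; rewrite !exprS IH ring_at_fracM.
by apply: ring_at_frac_eq; rewrite denM !den1 !mul1r.
Qed.

(** Denominators are cleared. A multiplier [u] outside [P] is absorbed into [z] in the torsion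
    condition; squares need only vanish after multiplication by such a [u]. *)
Lemma ring_at_not_HMCM x y :
    y \in P ->
    (forall m z, y ^+ m * z = 0 -> y * z = 0) ->
    (forall z, y * z = 0 -> exists2 u, u \notin P & u * (z * z) = 0) ->
    y * x = 0 -> (forall u, u \notin P -> u * x <> 0) ->
  ~ HMCM (ring_at P).
Proof.
move=> Py y_tors tors_nil yx0 x_neq0.
pose frac1 z := ring_at_frac z (denom1 (prime_compl P)).
apply: (@not_HMCM_of_annihilator _ (frac1 x) (frac1 y)).
- elim/ring_atW=> b s; rewrite ring_at_fracM => /ring_at_fracP[u Pu].
  rewrite den1 mul1r denM den1 mul1r mulr1 => e.
  have : u * den s \in P by rewrite -e mulrCA mulrC idealMr.
  rewrite prime_idealrM (negPf Pu) /=; apply/negP; exact: (denP s).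
- move=> m; elim/ring_atW=> a s; rewrite ring_at_fracX1 !ring_at_fracM.
  move=> /ring_at_frac_eq0[u Pu]; rewrite mulrCA => /y_tors e.
  by apply/ring_at_frac_eq0; exists u; rewrite // mulrCA.
- elim/ring_atW=> a s; rewrite !ring_at_fracM => /ring_at_frac_eq0[u Pu].
  rewrite mulrCA => /tors_nil[v Pv e]; apply/ring_at_frac_eq0.
  exists (v * u * u); first by rewrite !prime_idealrM !negb_or Pv Pu.
  by rewrite -e; ring.
- rewrite ring_at_fracM yx0; apply/ring_at_frac_eq0.
  by exists 1; rewrite ?mulr0 // idealr1.
- by move=> /ring_at_frac_eq0[u /x_neq0].
Qed.

End RingAt.

(** * Parity in Z/4 and the ring of glued pairs *)

(** Evenness of [c] is encoded as [2 * c = 0]; the even residues thus form a prime ideal. *)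
Lemma Z4_even_mul (c d : 'Z_4) : 2 * (c * d) = 0 <-> 2 * c = 0 \/ 2 * d = 0.
Proof.
split=> [|[]]; by move: c d => [[|[|[|[|//]]]] ?] [[|[|[|[|//]]]] ?] // _;
  (left; exact: val_inj) || (right; exact: val_inj) || exact: val_inj.
Qed.

Lemma Z4_odd_sqr (c : 'Z_4) : 2 * c <> 0 -> c * c = 1.
Proof.
by move: c => [[|[|[|[|//]]]] ?] c_odd;
  (case: c_odd; exact: val_inj) || exact: val_inj.
Qed.

Lemma Z4_even_sqr (c : 'Z_4) : 2 * c = 0 -> c * c = 0.
Proof.
by move: c => [[|[|[|[|//]]]] ?] // _; exact: val_inj.
Qed.

(* [z.1] is the fraction [a / b] with [b] odd, so the last clause says that
   [z.2 n] is eventually congruent to [z.1] modulo 2. *)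
Definition glued : {pred rat * (nat -> 'Z_4)} := fun z =>
  `[< exists a b : int, [/\ 2 * b%:~R <> 0 :> 'Z_4, b%:~R * z.1 = a%:~R &
        \forall n \near \oo%classic, 2 * (b%:~R * z.2 n) = 2 * a%:~R] >].

Fact glued_subring_closed : subring_closed glued.
Proof.
split.
- apply/asboolP; exists 1, 1; split => //.
  by apply: nearW => n; rewrite mul1r.
- move=> x y /asboolP[a [b [b_odd x1 x2]]] /asboolP[a' [b' [b'_odd y1 y2]]].
  apply/asboolP; exists (b' * a - b * a'), (b * b'); split.
  + by rewrite intrM => /Z4_even_mul[].
  + by rewrite /= intrM intrB !intrM -x1 -y1; ring.
  + apply: filterS2 x2 y2 => n xn yn.
    have -> : (x - y).2 n = x.2 n - y.2 n by [].
    rewrite intrM intrB !intrM.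
    transitivity (b'%:~R * (2 * (b%:~R * x.2 n)) -
                  b%:~R * (2 * (b'%:~R * y.2 n))).
      by ring.
    by rewrite xn yn; ring.
- move=> x y /asboolP[a [b [b_odd x1 x2]]] /asboolP[a' [b' [b'_odd y1 y2]]].
  apply/asboolP; exists (a * a'), (b * b'); split.
  + by rewrite intrM => /Z4_even_mul[].
  + by rewrite /= !intrM -x1 -y1; ring.
  + apply: filterS2 x2 y2 => n xn yn.
    have -> : (x * y).2 n = x.2 n * y.2 n by [].
    rewrite !intrM.
    transitivity ((2 * (b%:~R * x.2 n)) * (b'%:~R * y.2 n)); first by ring.
    rewrite xn; transitivity (a%:~R * (2 * (b'%:~R * y.2 n))); first by ring.
    by rewrite yn; ring.
Qed.

HB.instance Definition _ :=
  GRing.isSubringClosed.Build _ glued glued_subring_closed.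

Definition glued_ring : Type := {z : rat * (nat -> 'Z_4) | z \in glued}.

HB.instance Definition _ := Choice.on glued_ring.
HB.instance Definition _ := SubType.on glued_ring.
HB.instance Definition _ := [SubChoice_isSubComNzRing of glued_ring by <:].

Definition glue x (xP : x \in glued) : glued_ring := exist _ x xP.

Implicit Types z : glued_ring.

Definition ratpart z : rat := (val z).1.
Definition tail z : nat -> 'Z_4 := (val z).2.

Lemma glued_ringP z w : ratpart z = ratpart w -> tail z = tail w -> z = w.
Proof.
case: z w => [[f d] zP] [[g e] wP]; rewrite /ratpart /tail /= => fg de.
by apply: val_inj; rewrite /= fg de.
Qed.

Lemma ratpartM z w : ratpart (z * w) = ratpart z * ratpart w. Proof. by []. Qed.
Lemma tailM z w n : tail (z * w) n = tail z n * tail w n. Proof. by []. Qed.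
Lemma ratpartX z m : ratpart (z ^+ m) = ratpart z ^+ m.
Proof. by elim: m => // m IH; rewrite !exprS ratpartM IH. Qed.

(** * The primes of the glued ring, and its units *)

Definition at_point n : {pred glued_ring} := fun z => 2 * tail z n == 0.
(** This is the prime q: the tail is eventually congruent to the rational part modulo 2, so the
    latter is even. *)
Definition at_infinity : {pred glued_ring} := fun z =>
  `[< \forall n \near \oo%classic, 2 * tail z n = 0 >].

Fact at_point_idealr n : idealr_closed (at_point n).
Proof.
split=> [||c x y]; rewrite !unfold_in ?mulr0 //.
move=> /eqP x0 /eqP y0; apply/eqP.
have -> : tail (c * x + y) n = tail c n * tail x n + tail y n by [].
by rewrite mulrDr mulrCA x0 y0 mulr0 addr0.
Qed.

Fact at_point_prime n : prime_idealr_closed (at_point n).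
Proof.
move=> x y; rewrite !unfold_in tailM => /eqP/Z4_even_mul[] ->.
  by rewrite eqxx.
by rewrite eqxx orbT.
Qed.

HB.instance Definition _ n := isIdealr.Build _ (at_point n) (at_point_idealr n).
HB.instance Definition _ n :=
  isPrimeIdealrClosed.Build _ (at_point n) (@at_point_prime n).

(** The tail eventually has the parity of the numerator [a]. This is what makes [at_infinity]
    prime. *)
Lemma tail_dichotomy z :
  (\forall n \near \oo%classic, 2 * tail z n = 0) \/
  (\forall n \near \oo%classic, 2 * tail z n <> 0).
Proof.
have /asboolP[a [b [b_odd _ z2]]] := valP z.
have [a_even|a_odd] := EM (2 * a%:~R = 0 :> 'Z_4).
  by left; apply: filterS z2 => n; rewrite a_even => /Z4_even_mul[].
right; apply: filterS z2 => n e f; apply: a_odd.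
by rewrite -e; apply/Z4_even_mul; right.
Qed.

Lemma notin_at_infinity z : z \notin at_infinity ->
  \forall n \near \oo%classic, 2 * tail z n <> 0.
Proof. by move=> /asboolPn nz; case: (tail_dichotomy z). Qed.

Fact at_infinity_idealr : idealr_closed at_infinity.
Proof.
split=> [||c x y].
- by apply/asboolP; apply: nearW => n; exact: mulr0.
- by apply/asboolPn => /filter_ex[n].
- move=> /asboolP x0 /asboolP y0; apply/asboolP.
  apply: filterS2 x0 y0 => n x0 y0.
  have -> : tail (c * x + y) n = tail c n * tail x n + tail y n by [].
  by rewrite mulrDr mulrCA x0 y0 mulr0 addr0.
Qed.

Fact at_infinity_prime : prime_idealr_closed at_infinity.
Proof.
move=> x y /asboolP xy0; apply/orP; rewrite -!/(is_true (_ \in at_infinity)).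
have [x0|x1] := boolP (x \in at_infinity); first by left.
right; apply/asboolP; apply: filterS2 (notin_at_infinity x1) xy0 => n x1n.
by rewrite tailM => /Z4_even_mul[].
Qed.

HB.instance Definition _ := isIdealr.Build _ at_infinity at_infinity_idealr.
HB.instance Definition _ :=
  isPrimeIdealrClosed.Build _ at_infinity (@at_infinity_prime).

(** A zero rational part has numerator 0, which forces an eventually even tail. *)
Lemma ratpart_neq0 z : z \notin at_infinity -> ratpart z != 0.
Proof.
move=> z_odd; have /asboolP[a [b [b_odd z1 z2]]] := valP z.
apply: contraNneq z_odd => z0; apply/asboolP.
move: z1; rewrite -/(ratpart z) z0 mulr0 => /esym/eqP.
rewrite intr_eq0 => /eqP a0.
by apply: filterS z2 => n; rewrite a0 mulr0 => /Z4_even_mul[].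
Qed.

Lemma glued_of_even_tail (d : nat -> 'Z_4) :
  (\forall n \near \oo%classic, 2 * d n = 0) -> (0, d) \in glued.
Proof.
move=> d0; apply/asboolP; exists 0, 1; split; rewrite ?mulr0 //.
by apply: filterS d0 => n; rewrite mul1r.
Qed.

Definition of_even_tail d d_even : glued_ring :=
  glue (@glued_of_even_tail d d_even).

Lemma delta_tail_even n :
  \forall m \near \oo%classic, 2 * (m == n)%:R = 0 :> 'Z_4.
Proof. by exists n.+1 => // m /= nm; rewrite gtn_eqF // mulr0. Qed.

Definition point_idem n : glued_ring := of_even_tail (delta_tail_even n).

(** The idempotent sees only the entry at [n], and even residues square to zero in Z/4. *)
Lemma point_idem_annihilates n z :
  z \in at_point n -> point_idem n * z ^+ 2 = 0.
Proof.
move=> /eqP zn; apply: glued_ringP; first by rewrite ratpartM mul0r.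
apply/funext => m; rewrite tailM.
have -> : tail (point_idem n) m = (m == n)%:R by [].
have [->|_] := eqVneq m n; last by rewrite mul0r.
by rewrite mul1r expr2 tailM (Z4_even_sqr zn).
Qed.

Lemma glued_unit z : (forall n, z \notin at_point n) -> exists w, w * z = 1.
Proof.
move=> z_odd; have {}z_odd n : 2 * tail z n <> 0 by apply/eqP/z_odd.
have /asboolP[a [b [b_odd z1 z2]]] := valP z.
(* One index where the congruence holds suffices, since [b] and the entry there are odd. *)
have a_odd : 2 * a%:~R <> 0 :> 'Z_4.
  have [n e] := filter_ex z2.
  by rewrite -e => /Z4_even_mul[] //; apply: z_odd.
have z_neq0 : ratpart z != 0.
  by apply: ratpart_neq0; apply/asboolPn => /filter_ex[n]; exact: z_odd.
(* Odd residues modulo 4 are their own inverses, so the inverse of [z] keeps its tail. *)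
have winv : ((ratpart z)^-1, tail z) \in glued.
  apply/asboolP; exists b, a; split => //.
    by rewrite /= -z1 mulfK.
  apply: filterS z2 => n /= e.
  transitivity ((2 * a%:~R) * tail z n); first by ring.
  rewrite -e; transitivity (2 * b%:~R * (tail z n * tail z n)).
    by rewrite /tail; ring.
  by rewrite (Z4_odd_sqr (z_odd n)) mulr1.
exists (glue winv); apply: glued_ringP; first exact: (mulVf z_neq0).
by apply/funext => n; exact: (Z4_odd_sqr (z_odd n)).
Qed.

Lemma glued_ring_HMCM : HMCM glued_ring.
Proof.
apply: HMCM_of_locally_nilpotent => z z_nonunit.
have [n zn] : exists n, z \in at_point n.
  apply: contrapT => z_odd; have [|w /z_nonunit//] := @glued_unit z.
  by move=> n; apply/negP => zn; apply: z_odd; exists n.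
exists (at_point n : prime_idealr _), (point_idem n), 2; split => //.
  by rewrite unfold_in /tail /= eqxx.
exact: point_idem_annihilates.
Qed.

(** * Failure of HMCM at infinity *)

Fact two_glued : ((2, fun=> 0) : rat * (nat -> 'Z_4)) \in glued.
Proof.
apply/asboolP; exists 2, 1; split => //.
by apply: nearW => n; exact: val_inj.
Qed.

Definition two_elt : glued_ring := glue two_glued.

Lemma tail_two_even : \forall n \near \oo%classic, 2 * 2 = 0 :> 'Z_4.
Proof. by apply: nearW => n; exact: val_inj. Qed.

Definition nil_elt : glued_ring := of_even_tail tail_two_even.

Lemma at_infinity_not_HMCM : ~ HMCM (ring_at at_infinity).
Proof.
apply: (@ring_at_not_HMCM _ _ nil_elt two_elt).
- by apply/asboolP; apply: nearW => n; exact: mulr0.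
(* [two_elt] has tail 0 and nonzero rational part, so its powers kill only elements of rational part
   0, and [two_elt] kills all of these. *)
- move=> m z e; apply: glued_ringP; last first.
    by apply/funext => n; rewrite tailM; exact: mul0r.
  have : ratpart (two_elt ^+ m * z) = 0 by rewrite e.
  rewrite !ratpartM ratpartX => /eqP.
  rewrite mulf_eq0 expf_eq0 andbF => /eqP ->.
  exact: mulr0.
- move=> z e.
  have ratpart_z : ratpart z = 0.
    have : ratpart (two_elt * z) = 0 by rewrite e.
    by rewrite ratpartM => /eqP; rewrite mulf_eq0 => /eqP.
  have /asboolP z_even : z \in at_infinity.
    by apply: contra_eqT ratpart_z => /ratpart_neq0.
  (* The multiplier removes the odd entries of [z], and the even ones square to zero. It lies
     outside [at_infinity] because [z] is eventually even. *)
  have uP : (1, fun n => (2 * tail z n == 0)%:R) \in glued.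
    apply/asboolP; exists 1, 1; split => //.
    by apply: filterS z_even => n /= ->; rewrite eqxx mul1r.
  exists (glue uP).
    apply/asboolPn => u_even.
    have [n [/=]] := filter_ex (filterI u_even z_even).
    have -> : tail (glue uP) n = (2 * tail z n == 0)%:R by [].
    by move=> + z_even_n; rewrite z_even_n eqxx.
  apply: glued_ringP; first by rewrite !ratpartM ratpart_z !mulr0.
  apply/funext => n; rewrite !tailM {1}/tail /=.
  have [/Z4_even_sqr ->|_] := eqVneq (2 * tail z n) 0; first exact: mulr0.
  by rewrite mul0r.
- apply: glued_ringP; first exact: mulr0.
  by apply/funext => n; exact: mul0r.
(* Some entry of [u] is odd, and twice an odd residue is nonzero in Z/4. *)
- move=> u /notin_at_infinity/filter_ex[n u_odd] e; apply: u_odd.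
  by rewrite mulrC -[LHS]/(tail (u * nil_elt) n) e.
Qed.

Theorem corollary5p2 (k : fieldType) (k_infinite : infinite_set [set: k]%classic) :
  exists (B : comNzRingType) (q : prime_idealr B), HMCM B /\ ~ HMCM (ring_at q).
Proof.
exists glued_ring, at_infinity.
by split; [exact: glued_ring_HMCM | exact: at_infinity_not_HMCM].
Qed.
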